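(* For every locally compact group $G$, \[ \Lambda(G^{\mathsf{LUC}})=\Lambda^{\mathsf{CBP}}(G^{\mathsf{LUC}})=G. \]
   Context: All topological spaces and groups are Hausdorff; all linear spaces are over $\mathbb{R}$ and all functions and functionals are real-valued. Let $G$ be a topological group. A pseudometric $\Delta$ on $G$ is right-invariant if $\Delta(x,y)=\Delta(xz,yz)$ for all $x,y,z\in G$. The right uniformity on $G$ is the uniformity induced by the set of all right-invariant continuous pseudometrics on $G$. $\mathsf{LUC}(G)$ is the space of bounded real-valued functions on $G$ that are uniformly continuous with respect to the right uniformity, with the supremum norm, and $\mathsf{LUC}(G)^\ast$ is its norm dual. The weak$^\ast$ topology on $\mathsf{LUC}(G)^\ast$ is the topology of pointwise convergence on $\mathsf{LUC}(G)$; subsets $S$ of $\mathsf{LUC}(G)^\ast$ carry the relative weak$^\ast$ topology. Convolution on $\mathsf{LUC}(G)^\ast$ is defined by $(\mathfrak{m}\star\mathfrak{n})(f)=\mathfrak{m}\big(x\mapsto \mathfrak{n}(y\mapsto f(xy))\big)$ for $\mathfrak{m},\mathfrak{n}\in\mathsf{LUC}(G)^\ast$, $f\in\mathsf{LUC}(G)$. $G$ is identified with a subset of $\mathsf{LUC}(G)^\ast$ by mapping $x\in G$ to the functional $f\mapsto f(x)$. $G^{\mathsf{LUC}}$ denotes the weak$^\ast$ closure of $G$ in $\mathsf{LUC}(G)^\ast$. A subset $B$ of a topological space $K$ has the Baire property in $K$ if it differs from some open set by a meager set (the symmetric difference is meager in $K$). A subset $A$ of a topological space $X$ is a CBP set if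 for every compact (Hausdorff) space $K$ and every continuous mapping $\varphi\colon K\to X$ the set $\varphi^{-1}(A)$ has the Baire property in $K$. A function $h\colon X\to\mathbb{R}$ is CBP measurable if $h^{-1}(U)$ is a CBP set in $X$ for every open $U\subseteq\mathbb{R}$. For $S\subseteq\mathsf{LUC}(G)^\ast$: - $\Lambda(S)$ is the set of all $\mathfrak{m}\in S$ such that for every $f\in\mathsf{LUC}(G)$ the function $\mathfrak{n}\mapsto(\mathfrak{m}\star\mathfrak{n})(f)$ is weak$^\ast$ continuous on $S$; - $\Lambda^{\mathsf{CBP}}(S)$ is the set of all $\mathfrak{m}\in S$ such that for every $f\in\mathsf{LUC}(G)$ the function $\mathfrak{n}\mapsto(\mathfrak{m}\star\mathfrak{n})(f)$ is CBP measurable on $S$ with the weak$^\ast$ topology. *)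

(* Defs.v *)
From HB Require Import structures.
From mathcomp Require Import all_boot all_order all_algebra.
From mathcomp Require Import all_classical all_reals all_analysis.

Set Implicit Arguments.
Unset Strict Implicit.
Unset Printing Implicit Defensive.

Import Order.TTheory GRing.Theory Num.Theory.
Import numFieldNormedType.Exports.

Local Open Scope classical_set_scope.
Local Open Scope ring_scope.

HB.mixin Record isTopologicalGroup G & Topological G & Group G := {
  mulg_continuous : continuous (fun xy : G * G => (xy.1 * xy.2)%g) ;
  invg_continuous : continuous (fun x : G => x^-1%g) }.

#[short(type="topologicalGroupType")]
HB.structure Definition TopologicalGroup :=
  { G of Topological G & Group G & isTopologicalGroup G }.

(* An alias of G carrying the right uniformity. Its canonical topology is the
   one induced by that uniformity. *)
Definition right_uniform (R : realType) (G : topologicalGroupType) : Type := G.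

Section right_uniformity.
Context (R : realType) (G : topologicalGroupType).

Record right_invariant_pseudometric (D : G -> G -> R) : Prop := {
  rip_ge0 : forall x y, 0 <= D x y ;
  rip_refl : forall x, D x x = 0 ;
  rip_sym : forall x y, D x y = D y x ;
  rip_triangle : forall x y z, D x z <= D x y + D y z ;
  rip_invariant : forall x y z, D (x * z)%g (y * z)%g = D x y ;
  rip_continuous : continuous (fun xy : G * G => D xy.1 xy.2 : R^o) }.

Lemma rip0 : right_invariant_pseudometric (fun _ _ => 0).
Proof.
by split=> *; rewrite ?addr0 ?lexx//; exact: cvg_cst.
Qed.

Definition right_entourage : set_system (G * G) :=
  smallest Filter [set E | exists D (e : R),
    [/\ right_invariant_pseudometric D, 0 < e &
        E = [set xy | D xy.1 xy.2 < e]]].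

Lemma right_entourageP (E : set (G * G)) : right_entourage E <->
  exists D (e : R), [/\ right_invariant_pseudometric D, 0 < e &
    [set xy | D xy.1 xy.2 < e] `<=` E].
Proof.
split=> [EE|[D [e [DP e0 DE]]]]; last first.
  move=> F [FF FD]; apply: (filterS DE); apply: FD.
  by exists D, e.
apply: (EE [set A | exists D (e : R), [/\ right_invariant_pseudometric D,
  0 < e & [set xy | D xy.1 xy.2 < e] `<=` A]]).
split; last by move=> A [D [e [DP e0 ->]]]; exists D, e; split.
split.
- exists (fun _ _ => 0), 1; split=> //.
  exact: rip0.
- move=> A B [D [d [DP d0 DA]]] [H [e [HP e0 HB]]].
  exists (fun x y => D x y + H x y), (Num.min d e); split.
  + split.
    * by move=> x y; rewrite addr_ge0// ?(rip_ge0 DP) ?(rip_ge0 HP).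
    * by move=> x; rewrite (rip_refl DP) (rip_refl HP) addr0.
    * by move=> x y; rewrite (rip_sym DP) (rip_sym HP).
    * move=> x y z; rewrite addrACA lerD//.
        exact: (rip_triangle DP).
      exact: (rip_triangle HP).
    * by move=> x y z; rewrite (rip_invariant DP) (rip_invariant HP).
    * move=> x; apply: cvgD; first exact: (rip_continuous DP).
      exact: (rip_continuous HP).
  + by rewrite lt_min d0.
  + move=> xy /=; rewrite lt_min => /andP[xyd xye]; split.
      by apply: DA; apply: le_lt_trans xyd; rewrite lerDl (rip_ge0 HP).
    by apply: HB; apply: le_lt_trans xye; rewrite lerDr (rip_ge0 DP).
- move=> A B AB [D [d [DP d0 DA]]]; exists D, d; split=> //.
  exact: subset_trans AB.
Qed.

Local Lemma right_entourage_diagonal (E : set (G * G)) :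
  right_entourage E -> diagonal `<=` E.
Proof.
move=> /right_entourageP[D [e [DP e0 DE]]] [x y] /= xy; apply: DE => /=.
by rewrite (_ : x = y)// (rip_refl DP).
Qed.

Local Lemma right_entourage_inv (E : set (G * G)) :
  right_entourage E -> right_entourage (E^-1)%relation.
Proof.
move=> /right_entourageP[D [e [DP e0 DE]]]; apply/right_entourageP.
by exists D, e; split=> // -[x y]/= xy; apply: DE; rewrite /= (rip_sym DP).
Qed.

Local Lemma right_entourage_split (E : set (G * G)) : right_entourage E ->
  exists2 B, right_entourage B & (B \; B `<=` E)%relation.
Proof.
move=> /right_entourageP[D [e [DP e0 DE]]].
exists [set xy | D xy.1 xy.2 < e / 2].
  by apply/right_entourageP; exists D, (e / 2); split=> //; exact: divr_gt0.
move=> [x z] [y /= xy yz]; apply: DE => /=.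
by rewrite (le_lt_trans (rip_triangle DP x y z))// (splitr e) ltrD.
Qed.

HB.instance Definition _ := Choice.on (right_uniform R G).
HB.instance Definition _ := @isUniform.Build (right_uniform R G) right_entourage
  (smallest_filter_filter _) right_entourage_diagonal right_entourage_inv
  right_entourage_split.

End right_uniformity.

Section LUC.
Context (R : realType) (G : topologicalGroupType).

Definition is_luc : {pred G -> R^o} := fun f =>
  `[< bounded_fun f /\ unif_continuous (f : right_uniform R G -> R^o) >].

Record LUC := MkLUC { luc_val :> G -> R^o ; luc_valP : luc_val \in is_luc }.

HB.instance Definition _ := [isSub for luc_val].
HB.instance Definition _ := [Choice of LUC by <:].

Lemma is_lucP (f : G -> R^o) : reflect
  ((exists M : R, forall x, `|f x| <= M) /\
   (forall e : R, 0 < e -> exists D (d : R),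
     [/\ right_invariant_pseudometric D, 0 < d &
         forall x y, D x y < d -> `|f x - f y| < e]))
  (f \in is_luc).
Proof.
have PF : ProperFilter (globally [set: G]).
  exact: (globally_properfilter (a := 1%g)).
apply: (iffP (asboolP _)) => -[bf uf]; split.
- by move/ex_bound: bf => [M bf]; exists M => x; exact: bf.
- move=> e e0; have /uf : entourage [set xy : R^o * R^o | `|xy.1 - xy.2| < e].
    by rewrite -entourage_ballE; exists e.
  move=> /right_entourageP[D [d [DP d0 Dd]]]; exists D, d; split=> // x y xy.
  exact: (Dd (x, y)).
- by apply/ex_bound; case: bf => M bf; exists M => x _; exact: bf.
- move=> A; rewrite -entourage_ballE => -[e /= e0 eA].
  have [D [d [DP d0 Dd]]] := uf _ e0.
  apply/right_entourageP; exists D, d; split=> // -[x y]/= xy.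
  by apply: eA; exact: Dd.
Qed.

Local Lemma is_luc_submod_closed : submod_closed is_luc.
Proof.
split.
  apply/is_lucP; split; first by exists 0 => x; rewrite normr0.
  move=> e e0; exists (fun _ _ => 0), 1; split=> //.
    exact: rip0.
  by move=> x y _; rewrite subrr normr0.
move=> a f g /is_lucP[[M fM] fu] /is_lucP[[N gN] gu]; apply/is_lucP; split.
  exists (`|a| * M + N) => x.
  rewrite (le_trans (ler_normD _ _))// lerD// normrM ler_wpM2l//.
have a1 : 0 < `|a| + 1 by rewrite ltr_wpDl.
move=> e e0; have e2 : 0 < e / 2 / (`|a| + 1) by rewrite !divr_gt0.
have [D [d [DP d0 fD]]] := fu _ e2.
have [E [c [EP c0 gE]]] := gu _ (divr_gt0 e0 (ltr0n _ 2)).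
have /right_entourageP[H [b [HP b0 Hb]]] : @right_entourage R G
    ([set xy | D xy.1 xy.2 < d] `&` [set xy | E xy.1 xy.2 < c]).
  by apply: (@filterI _ _ (smallest_filter_filter _)); apply/right_entourageP; [exists D, d; split|exists E, c; split].
exists H, b; split=> // x y /(Hb (x, y))[/= /fD fxy /gE gxy].
rewrite (_ : _ - _ = a * (f x - f y) + (g x - g y)); last first.
  by rewrite mulrBr addrACA -opprD.
rewrite (le_lt_trans (ler_normD _ _))// (splitr e) ler_ltD// normrM.
move: fxy; rewrite ltr_pdivlMr// => /ltW; apply: le_trans.
by rewrite mulrC ler_wpM2l// lerDl.
Qed.

HB.instance Definition _ :=
  GRing.isSubmodClosed.Build R (G -> R^o) is_luc is_luc_submod_closed.
HB.instance Definition _ := [SubChoice_isSubLmodule of LUC by <:].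

Definition luc_norm (f : LUC) : R := sup [set `|f x| | x in setT].

Lemma luc_norm_ub (f : LUC) x : `|f x| <= luc_norm f.
Proof.
apply: ub_le_sup; last by exists x.
have /is_lucP[[M fM] _] := luc_valP f.
by exists M => _ [y _ <-].
Qed.

Lemma luc_norm_le (f : LUC) (M : R) : (forall x, `|f x| <= M) -> luc_norm f <= M.
Proof.
move=> fM; apply: ge_sup; first by exists `|f 1%g|, 1%g.
by move=> _ [x _ <-].
Qed.

Local Lemma luc_normD f g : luc_norm (f + g) <= luc_norm f + luc_norm g.
Proof.
apply: luc_norm_le => x; rewrite (le_trans (ler_normD _ _))//.
by rewrite lerD// luc_norm_ub.
Qed.

Local Lemma luc_normZ (a : R) f : luc_norm (a *: f) = `|a| * luc_norm f.
Proof.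
have le b g : luc_norm (b *: g) <= `|b| * luc_norm g.
  by apply: luc_norm_le => x; rewrite normrM ler_wpM2l// luc_norm_ub.
apply/eqP; rewrite eq_le le/=; have [->|a0] := eqVneq a 0.
  rewrite normr0 mul0r; apply: le_trans (luc_norm_ub _ 1%g).
  exact: normr_ge0.
rewrite -ler_pdivlMl ?normr_gt0// -normfV.
by rewrite -[X in luc_norm X <= _](scalerK a0) le.
Qed.

Local Lemma luc_norm0_eq0 f : luc_norm f = 0 -> f = 0.
Proof.
move=> f0; apply/val_inj/funext => x /=; apply/eqP.
by rewrite -normr_le0 -f0 luc_norm_ub.
Qed.

HB.instance Definition _ := Lmodule_isNormed.Build R LUC
  luc_normD luc_normZ luc_norm0_eq0.

Lemma LUC_normE (f : LUC) : `|f| = luc_norm f.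
Proof. by []. Qed.

End LUC.

Section norm_dual.
Context (R : realType) (V : normedModType R).

Definition is_dual : {pred V -> R^o} := fun m =>
  `[< linear (m : V -> R^o) /\ continuous (m : V -> R^o) >].

Record norm_dual :=
  MkDual { dual_val :> V -> R^o ; dual_valP : dual_val \in is_dual }.

HB.instance Definition _ := [isSub for dual_val].
HB.instance Definition _ := [Choice of norm_dual by <:].

Lemma is_dualP (m : V -> R^o) : reflect
  (linear m /\ exists C : R, forall f, `|m f| <= C * `|f|) (m \in is_dual).
Proof.
apply: (iffP (asboolP _)) => -[ml mc]; split=> //.
- pose m' := GRing.isLinear.Build R V R^o *:%R m ml.
  pose M : {linear V -> R^o} := HB.pack m m'.
  have /linear_boundedP/pinfty_ex_gt0[C _ HC] :
    bounded_near M (nbhs 0) by apply/linear_bounded_continuous.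
  by exists C.
- pose m' := GRing.isLinear.Build R V R^o *:%R m ml.
  pose M : {linear V -> R^o} := HB.pack m m'.
  apply: (bounded_linear_continuous (f := M)); apply/linear_boundedP.
  case: mc => C HC; near=> r => x.
  by rewrite (le_trans (HC x))// ler_wpM2r//; near: r; exact: nbhs_pinfty_ge.
Unshelve. all: by end_near. Qed.

(* The weak* topology: the norm topology of the dual plays no role here, so the
   canonical topology of norm_dual is that of pointwise convergence. *)
HB.instance Definition _ := Topological.copy norm_dual
  (initial_topology (fun m : norm_dual => (dual_val m : {ptws V -> R^o}))).

End norm_dual.

Section convolution.
Context (R : realType) (G : topologicalGroupType).
Implicit Types (f : LUC R G) (m n : norm_dual (LUC R G)).

Local Lemma luc_translate_subproof (x : G) f :
  (fun y => f (x * y)%g) \in @is_luc R G.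
Proof.
have /is_lucP[[M fM] fu] := luc_valP f; apply/is_lucP; split.
  by exists M => y.
move=> e /fu[D [d [DP d0 Dd]]].
exists (fun y z => D (x * y)%g (x * z)%g), d; split=> //.
  split.
  - by move=> *; exact: (rip_ge0 DP).
  - by move=> *; exact: (rip_refl DP).
  - by move=> *; exact: (rip_sym DP).
  - by move=> *; exact: (rip_triangle DP).
  - by move=> *; rewrite !mulgA (rip_invariant DP).
  - have xc : continuous (fun y : G => (x * y)%g).
      move=> y.
      apply: (@cvg_comp _ _ _ (fun y : G => (x, y))
        (fun xy : G * G => (xy.1 * xy.2)%g)); last exact: (mulg_continuous (x, y)).
      by apply: cvg_pair => //; exact: cvg_cst.
    move=> yz; apply: (@continuous_comp _ _ _
      (fun yz : G * G => ((x * yz.1)%g, (x * yz.2)%g))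
      (fun xy : G * G => D xy.1 xy.2 : R^o)); last exact: (rip_continuous DP).
    apply: cvg_pair.
      by apply: cvg_comp; [exact: cvg_fst|exact: xc].
    by apply: cvg_comp; [exact: cvg_snd|exact: xc].
by move=> y z; exact: Dd.
Qed.

Definition luc_translate (x : G) f : LUC R G :=
  MkLUC (luc_translate_subproof x f).

Local Lemma luc_act_subproof n f :
  (fun x => n (luc_translate x f)) \in @is_luc R G.
Proof.
have /is_dualP[nl [C nC]] := dual_valP n.
have /is_lucP[[M fM] fu] := luc_valP f.
have {}nC g : `|n g| <= (`|C| + 1) * `|g|.
  rewrite (le_trans (nC g))// ler_wpM2r// (le_trans (ler_norm C))//.
  by rewrite lerDl.
have C1 : 0 < `|C| + 1 by rewrite ltr_wpDl.
apply/is_lucP; split.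
  exists ((`|C| + 1) * M) => x; rewrite (le_trans (nC _))// ler_wpM2l ?(ltW C1)//.
  by rewrite LUC_normE; apply: luc_norm_le => y; exact: fM.
move=> e e0; have e2 : 0 < e / 2 / (`|C| + 1) by rewrite !divr_gt0.
have [D [d [DP d0 Dd]]] := fu _ e2.
exists D, d; split=> // x x' xx'.
have -> : n (luc_translate x f) - n (luc_translate x' f) =
    n (luc_translate x f - luc_translate x' f).
  by rewrite -scaleN1r addrC -nl scaleN1r addrC.
rewrite (le_lt_trans (nC _))// (@le_lt_trans _ _ (e / 2))//; last first.
  by rewrite ltr_pdivrMr// ltr_pMr// ltr1n.
rewrite mulrC -ler_pdivlMr// LUC_normE; apply: luc_norm_le => y /=.
by apply/ltW/Dd; rewrite (rip_invariant DP).
Qed.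

(* luc_act n f is the function x |-> n (y |-> f (x y)), so that
   (conv m n) f = m (x |-> n (y |-> f (x y))). *)
Definition luc_act n f : LUC R G := MkLUC (luc_act_subproof n f).

Local Lemma conv_subproof m n :
  (fun f => m (luc_act n f)) \in @is_dual R (LUC R G).
Proof.
have /is_dualP[ml [B mB]] := dual_valP m.
have /is_dualP[nl [C nC]] := dual_valP n.
apply/is_dualP; split.
  move=> a f g; rewrite -ml; congr (m _); apply/val_inj/funext => x /=.
  have -> : luc_translate x (a *: f + g) =
      a *: luc_translate x f + luc_translate x g by apply/val_inj/funext.
  exact: nl.
exists (`|B| * `|C|) => f; rewrite (le_trans (mB _))//.
rewrite (@le_trans _ _ (`|B| * `|luc_act n f|)) ?ler_wpM2r ?ler_norm//.
rewrite -mulrA ler_wpM2l// LUC_normE; apply: luc_norm_le => x /=.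
rewrite (le_trans (nC _))// (@le_trans _ _ (`|C| * `|luc_translate x f|))//.
  by rewrite ler_wpM2r ?ler_norm.
rewrite ler_wpM2l// !LUC_normE; apply: luc_norm_le => y /=.
exact: luc_norm_ub.
Qed.

Definition conv m n : norm_dual (LUC R G) := MkDual (conv_subproof m n).

Lemma convE m n f : conv m n f = m (luc_act n f).
Proof. by []. Qed.

Local Lemma luc_eval_subproof (x : G) :
  (fun f => f x) \in @is_dual R (LUC R G).
Proof.
apply/is_dualP; split=> //; exists 1 => f.
by rewrite mul1r LUC_normE; exact: luc_norm_ub.
Qed.

Definition luc_eval (x : G) : norm_dual (LUC R G) :=
  MkDual (luc_eval_subproof x).

Definition LUC_compactification : set (norm_dual (LUC R G)) :=
  closure (range luc_eval).

End convolution.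

Arguments luc_eval R {G} x.
Arguments LUC_compactification R G : clear implicits.

Section CBP.

Definition nowhere_dense (K : topologicalType) (A : set K) :=
  (closure A)° = set0.

Definition meager (K : topologicalType) (A : set K) :=
  exists F : nat -> set K,
    (forall n, nowhere_dense (F n)) /\ A = \bigcup_n F n.

Definition baire_property (K : topologicalType) (B : set K) :=
  exists U : set K, open U /\ meager (B `+` U).

Definition CBP_set (X : topologicalType) (A : set X) :=
  forall (K : topologicalType) (phi : K -> X),
    compact [set: K] -> hausdorff_space K -> continuous phi ->
    baire_property (phi @^-1` A).

Definition CBP_measurable (R : realType) (X : topologicalType) (h : X -> R^o) :=
  forall U : set R^o, open U -> CBP_set (h @^-1` U).

End CBP.

Section topological_centres.
Context (R : realType) (G : topologicalGroupType).

Definition Lambda (S : set (norm_dual (LUC R G))) :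
    set (norm_dual (LUC R G)) :=
  [set m | S m /\ forall f : LUC R G,
    continuous (fun n : S => conv m (set_val n) f)].

Definition Lambda_CBP (S : set (norm_dual (LUC R G))) :
    set (norm_dual (LUC R G)) :=
  [set m | S m /\ forall f : LUC R G,
    CBP_measurable (fun n : S => conv m (set_val n) f)].

End topological_centres.

(* Main.v *)
Require Import Defs.
From Stdlib Require Import Wellfounded.
From mathcomp Require Import wochoice.
From mathcomp Require Import all_boot all_order all_algebra.
From mathcomp Require Import all_classical all_reals all_analysis.
From mathcomp Require Import lra.

(* Let m lie in the CBP centre, and write m as a limit of points of G along an
   ultrafilter. For a right-invariant pseudometric D with relatively compact unit
   ball and a maximal 1-separated set X = {x_t}, every point of G is in the unit
   ball times X, so by compactness m(f) = lim_(t -> p) f(u x_t) for some u in G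
   and some ultrafilter p on the indices. If p is principal then m is in G.

   Otherwise m is refuted by one function f. By transfinite recursion one chooses
   points y_(F,z), for F a finite set of indices and z : F -> {0,1}, such that the
   points x_t y_(F,z) with t in F are all 1-separated; a sum of bumps gives f in
   LUC(G) with f(u x_t y_(F,z)) = z(t). Hence n |-> (n(y |-> f(u x_t y)))_t maps a
   compact subset of the compactification onto 2^T, irreducibly on some compact K,
   and (m * n)(f) is the p-limit of the coordinates of that image. A free
   ultrafilter, as a subset of 2^T, is invariant under finite changes and swapped
   with its complement by negation, so it lacks the Baire property, and by
   irreducibility so does its preimage in K. *)

Set Implicit Arguments.
Unset Strict Implicit.
Unset Printing Implicit Defensive.

Import Order.TTheory GRing.Theory Num.Theory.
Import numFieldNormedType.Exports.

Local Open Scope classical_set_scope.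

(** * Cardinality of lists and conflict-free choices *)

(** Comparability of cardinals: Zorn gives a maximal graph of a partial injection from [A] to [B].
    It is total on [A] or onto [B], since otherwise one more pair could be added. *)
Lemma injection_total (T : Type) (A B : set T) :
  (exists f : T -> T, [/\ forall x, A x -> B (f x) &
     forall x y, A x -> A y -> f x = f y -> x = y]) \/
  (exists f : T -> T, [/\ forall x, B x -> A (f x) &
     forall x y, B x -> B y -> f x = f y -> x = y]).
Proof.
pose P (g : set (T * T)) := [/\ forall x y, g (x, y) -> A x /\ B y,
  forall x y z, g (x, y) -> g (x, z) -> y = z &
  forall x y z, g (x, z) -> g (y, z) -> x = y].
have [F FP Ftot|g [[gAB gf gi] gmax]] := @Zorn_bigcup _ P.
  split.
  - by move=> x y [h /FP[hAB _ _] /hAB].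
  - move=> x y z [h Fh hxy] [k Fk kxz].
    have [hk|kh] := Ftot _ _ Fh Fk.
      by have [_ kf _] := FP _ Fk; exact: kf (hk _ hxy) kxz.
    by have [_ hf _] := FP _ Fh; exact: hf hxy (kh _ kxz).
  - move=> x y z [h Fh hxz] [k Fk kyz].
    have [hk|kh] := Ftot _ _ Fh Fk.
      by have [_ _ ki] := FP _ Fk; exact: ki (hk _ hxz) kyz.
    by have [_ _ hi] := FP _ Fh; exact: hi hxz (kh _ kyz).
have [domg|] := pselect (forall x, A x -> exists y, g (x, y)).
  left; have /choice[f fP] : forall x, exists y, A x -> g (x, y).
    move=> x; have [/domg[y gxy]|nAx] := pselect (A x); first by exists y.
    by exists x.
  exists f; split=> [x /fP/gAB[]//|x y /fP gx /fP gy fxy].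
  by apply: gi gx _; rewrite fxy.
move=> /existsNP[x0 /not_implyP[Ax0 nx0]].
have [rang|] := pselect (forall y, B y -> exists x, g (x, y)).
  right; have /choice[f fP] : forall y, exists x, B y -> g (x, y).
    move=> y; have [/rang[x gxy]|nBy] := pselect (B y); first by exists x.
    by exists y.
  exists f; split=> [y /fP/gAB[]//|x y /fP gx /fP gy fxy].
  by apply: gf gx _; rewrite fxy.
move=> /existsNP[y0 /not_implyP[By0 ny0]].
exfalso; apply: (gmax (g `|` [set (x0, y0)])).
  split; first exact: subsetUl.
  by move=> /(_ (x0, y0) (or_intror erefl)) gxy; apply: nx0; exists y0.
split.
- by move=> x y [/gAB//|[-> ->]].
- move=> x y z [gxy|[-> ->]] [gxz|[]].
  + exact: gf gxy gxz.
  + by move=> xx0 _; case: nx0; exists y; rewrite -xx0.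
  + by case: nx0; exists z.
  + by move=> ->.
- move=> x y z [gxz|[-> ->]] [gyz|[]].
  + exact: gi gxz gyz.
  + by move=> _ zy0; case: ny0; exists x; rewrite -zy0.
  + by case: ny0; exists y.
  + by move=> ->.
Qed.

Lemma infinite_nat_injection (T : Type) (A : set T) : infinite_set A ->
  exists2 j : nat -> T, injective j & forall n, A (j n).
Proof.
move=> /infiniteP/card_leP[k].
exists (fun n => val (k (SigSub (mem_set (I : [set: nat] n))))).
  move=> m n /val_inj/(@inj _ _ _ k).
  by move=> /(_ (in_setT _) (in_setT _))[].
by move=> n; exact: set_mem (valP (k _)).
Qed.

(** Zorn gives a maximal injection of the lists over a subset [B] into [B]. If the complement of [B]
    embeds into [B], so does [T], and lists over [T] are carried into [B]. Otherwise [B] has a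
    disjoint copy [C], and the injection extends to lists over [B] and [C]. *)
Lemma infinite_seq_injection (T : eqType) : infinite_set [set: T] ->
  exists i : seq T -> T, injective i.
Proof.
move=> /infinite_nat_injection[j jI _].
(* The base set is read off the graph from the one-element lists, so that graphs alone are ordered
   by inclusion. *)
pose B (g : set (seq T * T)) := [set t | exists v, g ([:: t], v)].
pose lists (C : set T) := [set s : seq T | forall t, t \in s -> C t].
pose good (g : set (seq T * T)) :=
  [/\ forall s v, g (s, v) -> lists (B g) s /\ B g v,
      forall s, lists (B g) s -> exists v, g (s, v),
      forall s v w, g (s, v) -> g (s, w) -> v = w &
      forall s t v, g (s, v) -> g (t, v) -> s = t].
pose P g := g = set0 \/ good g.
have [F FP Ftot|g [Pg gmax]] := @Zorn_bigcup _ P.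
  have [->|/set0P[g0 [h0 Fh0 h0g]]] := eqVneq (\bigcup_(X in F) X) set0.
    by left.
  have subB h : F h -> B h `<=` B (\bigcup_(X in F) X).
    by move=> Fh t [v hv]; exists v, h.
  have Fgood h s v : F h -> h (s, v) -> good h.
    by move=> Fh hsv; have [h0'|//] := FP _ Fh; move: hsv; rewrite h0'.
  right; split.
  - move=> s v [h Fh hsv]; have [hB _ _ _] := Fgood _ _ _ Fh hsv.
    have [hs hv] := hB _ _ hsv; split; last exact: subB hv.
    by move=> t /hs; exact: subB.
  - move=> s sB.
    have [h [Fh gh hs]] : exists h, [/\ F h, good h & lists (B h) s].
      elim: s sB => [_|t s IH stB].
        by case: g0 h0g => s v /(Fgood _ _ _ Fh0) gh0; exists h0; split.
      have [u us|h [Fh gh hs]] := IH; first by apply: stB; rewrite inE us orbT.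
      have [v [k Fk ktv]] := stB t (mem_head _ _).
      have gk := Fgood _ _ _ Fk ktv.
      have [hk|kh] := Ftot _ _ Fh Fk.
        exists k; split=> // u; rewrite inE => /predU1P[->|/hs[w /hk]].
          by exists v.
        by exists w.
      exists h; split=> // u; rewrite inE => /predU1P[->|/hs[w]].
        by exists v; exact: kh.
      by exists w.
    by have [_ hd _ _] := gh; have [v hv] := hd _ hs; exists v, h.
  - move=> s v w [h Fh hs] [k Fk ks].
    have [hk|kh] := Ftot _ _ Fh Fk.
      by have [_ _ kf _] := Fgood _ _ _ Fk ks; exact: kf (hk _ hs) ks.
    by have [_ _ hf _] := Fgood _ _ _ Fh hs; exact: hf hs (kh _ ks).
  - move=> s t v [h Fh hs] [k Fk ks].
    have [hk|kh] := Ftot _ _ Fh Fk.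
      by have [_ _ _ ki] := Fgood _ _ _ Fk ks; exact: ki (hk _ hs) ks.
    by have [_ _ _ hi] := Fgood _ _ _ Fh hs; exact: hi hs (kh _ ks).
(* A maximal [g] has no such extension: lists without a value would receive one in [C] through [i],
   which cannot clash with the old values in [B g]. *)
have extend (C : set T) (i : seq T -> T) : C !=set0 ->
    (forall t, C t -> ~ B g t) ->
    (forall s, lists (B g `|` C) s -> C (i s)) ->
    (forall s t, lists (B g `|` C) s -> lists (B g `|` C) t ->
       i s = i t -> s = t) -> False.
  move=> [c Cc] CB iC iI.
  pose k : set (seq T * T) := [set p | g p \/
    [/\ lists (B g `|` C) p.1, ~ (exists v, g (p.1, v)) & p.2 = i p.1]].
  have gB s v : g (s, v) -> lists (B g) s /\ B g v.
    by case: Pg => [->//|[gB _ _ _]]; exact: gB.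
  have kc : k ([:: c], i [:: c]).
    right; split=> //=; last exact: CB.
    by move=> t; rewrite inE => /eqP ->; right.
  have Bk : B k = B g `|` C.
    apply/seteqP; split=> [t [v [gtv|[/= /(_ t (mem_head _ _))]]]|t] //.
      by left; exists v.
    move=> [[v gv]|Ct]; first by exists v; left.
    exists (i [:: t]); right; split=> //=; last exact: CB.
    by move=> u; rewrite inE => /eqP ->; right.
  apply: (gmax k).
    split; first by move=> p; left.
    by move=> /(_ _ kc)/gB[/(_ c (mem_head _ _)) /(CB _ Cc)].
  right; split; rewrite ?Bk.
  - move=> s v [/gB[sB Bv]|/= [sBC _ ->]].
      by split; [move=> t /sB; left|left].
    by split=> //; right; exact: iC.
  - move=> s sBC; have [[v gv]|ns] := pselect (exists v, g (s, v)).
      by exists v; left.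
    by exists (i s); right.
  - move=> s v w [gv|/= [_ ns ->]] [gw|/= [_ ns' ->]] //.
    + by case: Pg => [g0|[_ _ gf _]]; [move: gv; rewrite g0|exact: gf gv gw].
    + by case: ns'; exists v.
    + by case: ns; exists w.
  - move=> s t v [gs|/= [sBC ns ->]] [gt|/= [tBC nt]].
    + by case: Pg => [g0|[_ _ _ gi]]; [move: gs; rewrite g0|exact: gi gs gt].
    + move=> viT; have [_] := gB _ _ gs.
      by rewrite viT => Bi; case: (CB _ _ Bi); exact: iC.
    + by have [_ Bi] := gB _ _ gt; case: (CB _ _ Bi); exact: iC.
    + exact: iI.
have {Pg} [g0|[gB gd gf gi]] := Pg.
  (* If [g] is empty, the copy [range j] of the naturals serves as [C], its lists being numbered by
     [pickle]. *)
  have Bg0 t : ~ B g t by rewrite g0 => -[v].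
  have /choice[r rP] : forall t, exists n, range j t -> j n = t.
    by move=> t; have [[n _ jn]|nr] := pselect (range j t); [exists n|exists 0].
  have rl s : lists (B g `|` range j) s -> map j (map r s) = s.
    move=> sr; rewrite -map_comp -[RHS]map_id; apply/eq_in_map => t /sr[/Bg0//|].
    exact: rP.
  exfalso; apply: (extend (range j) (fun s => j (pickle (map r s)))).
  - by exists (j 0), 0.
  - by move=> t _; exact: Bg0.
  - by move=> s _; exists (pickle (map r s)).
  - move=> s t /rl st /rl tt /jI/(pcan_inj pickleK) rst.
    by rewrite -st -tt rst.
have /choice[f fP] : forall s, exists v, lists (B g) s -> g (s, v).
  move=> s; have [/gd[v gv]|n] := pselect (lists (B g) s); first by exists v.
  by exists (j 0).
have fB s : lists (B g) s -> B g (f s) by move=> /fP/gB[].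
have fI s t : lists (B g) s -> lists (B g) t -> f s = f t -> s = t.
  by move=> /fP gs /fP gt st; apply: gi gs _; rewrite st.
(* The distinct elements a and b of B tag two copies of B inside lists over B,
   so that B + B embeds into B. *)
pose a := f [::]; pose b := f [:: a].
have nilB : lists (B g) [::] by [].
have aB : B g a by exact: fB.
have aaB : lists (B g) [:: a] by move=> t; rewrite inE => /eqP ->.
have bB : B g b by exact: fB.
have ab : a <> b by move=> /fI; move=> /(_ nilB aaB).
have pair (c d : T) : B g c -> B g d -> lists (B g) [:: c; d].
  by move=> Bc Bd t; rewrite !inE => /orP[] /eqP ->.
have fI2 c d c' d' : B g c -> B g d -> B g c' -> B g d' ->
    f [:: c; d] = f [:: c'; d'] -> c = c' /\ d = d'.
  by move=> *; have [] : [:: c; d] = [:: c'; d'] by apply: fI => //; exact: pair.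
have [[h [hC hI]]|[h [hC hI]]] := injection_total (B g) (~` B g).
  (* Here [e] squeezes [B] and its copy [C] into [B]; lists over both then go through [f] into [B]
     and through [h] into [C], against maximality. *)
  pose C := h @` (B g).
  have /choice[h' h'P] : forall t, exists u, C t -> B g u /\ h u = t.
    move=> t; have [[u Bu ut]|n] := pselect (C t); first by exists u.
    by exists t.
  pose e t := if t \in B g then f [:: a; t] else f [:: b; h' t].
  have CB t : C t -> ~ B g t by move=> [u /hC + <-].
  have eB t : (B g `|` C) t -> B g (e t).
    rewrite /e; case: ifPn => [/set_mem Bt _|/negP nBt [/mem_set//|Ct]].
      by apply: fB; exact: pair.
    by apply: fB; apply: pair => //; have [] := h'P _ Ct.
  have eI s t : (B g `|` C) s -> (B g `|` C) t -> e s = e t -> s = t.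
    rewrite /e; case: ifPn => [/set_mem Bs _|/negP nBs [/mem_set//|Cs]];
      case: ifPn => [/set_mem Bt _|/negP nBt [/mem_set//|Ct]].
    - by move=> /fI2[].
    - have [? _] := h'P _ Ct.
      by move=> /fI2[]// /ab.
    - have [? _] := h'P _ Cs.
      by move=> /fI2[]// /esym/ab.
    - have [? {2}<-] := h'P _ Cs; have [? {2}<-] := h'P _ Ct.
      by move=> /fI2[]// _ ->.
  have leB s : lists (B g `|` C) s -> lists (B g) (map e s).
    by move=> sBC _ /mapP[t /sBC /eB Bt ->].
  exfalso; apply: (extend C (fun s => h (f (map e s)))).
  - by exists (h a), a.
  - exact: CB.
  - by move=> s /leB sB; exists (f (map e s)) => //; exact: fB.
  - move=> s t sBC tBC /hI st.
    have /fI {st} : f (map e s) = f (map e t).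
      by apply: st; apply: fB; exact: leB.
    move=> /(_ (leB _ sBC) (leB _ tBC)).
    elim: s t sBC tBC => [|u s IH] [|v t]//= uBC vBC [uv st].
    have -> : u = v.
      by apply: eI uv; [exact: uBC (mem_head _ _)|exact: vBC (mem_head _ _)].
    congr (_ :: _); apply: IH st => w ws.
      by apply: uBC; rewrite inE ws orbT.
    by apply: vBC; rewrite inE ws orbT.
pose e t := if t \in B g then f [:: a; t] else f [:: b; h t].
have eB t : B g (e t).
  rewrite /e; case: ifPn => [/set_mem Bt|/negP nBt].
    by apply: fB; exact: pair.
  by apply: fB; apply: pair => //; apply: hC => /mem_set.
have eI : injective e.
  move=> s t; rewrite /e.
  case: ifPn => [/set_mem Bs|/negP nBs]; case: ifPn => [/set_mem Bt|/negP nBt].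
  - by move=> /fI2[].
  - have ? : B g (h t) by apply: hC => /mem_set.
    by move=> /fI2[]// /ab.
  - have ? : B g (h s) by apply: hC => /mem_set.
    by move=> /fI2[]// /esym/ab.
  - have ? : B g (h t) by apply: hC => /mem_set.
    have ? : B g (h s) by apply: hC => /mem_set.
    by move=> /fI2[]// _ /hI; apply => /mem_set.
exists (fun s => f (map e s)) => s t /fI st.
apply: (inj_map eI); apply: st => u /mapP[v _ ->]; exact: eB.
Qed.

(** If some initial segment of a well-order receives an injection from [T], let [m] be the least
    point bounding one and pull the order back along that injection; a segment still receiving [T]
    would contradict the choice of [m]. *)
Lemma initial_well_order (T : eqType) : exists lt : T -> T -> Prop,
  [/\ well_founded lt, forall x y, x <> y -> lt x y \/ lt y x &
      forall x, ~ exists2 i : T -> T, injective i & forall y, lt (i y) x].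
Proof.
have [R Rwo] := well_ordering_principle T.
pose slt x y := R x y /\ x <> y.
have Rmin (A : set T) : A !=set0 -> exists2 m, A m & forall x, A x -> R m x.
  move=> [x Ax]; have [|m [[mA mR] _]] := Rwo [pred x | x \in A].
    by exists x; rewrite !inE.
  exists m; first by move: mA; rewrite !inE.
  by move=> y Ay; apply: mR; rewrite !inE.
have RC : wo_chain R predT by move=> A _; exact: Rwo.
have Ranti x y : R x y -> R y x -> x = y.
  by move=> xy yx; apply: (wo_chain_antisymmetric RC) => //; rewrite xy yx.
have sltwf : well_founded slt.
  move=> x; apply: contrapT => nx.
  have [m nm mR] := Rmin [set x | ~ Acc slt x] (ex_intro _ x nx).
  apply: nm; constructor => y [ym yNm]; apply: contrapT => /mR my.
  by apply: yNm; exact: Ranti.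
have slt_tot x y : x <> y -> slt x y \/ slt y x.
  move=> xy; have /orP[] : R x y || R y x by exact: (wo_chainW RC).
    by left.
  by right; split=> // yx; exact: xy.
pose big a := exists2 i : T -> T, injective i & forall y, slt (i y) a.
have [[a biga]|nbig] := pselect (exists a, big a); last first.
  by exists slt; split=> // x bigx; apply: nbig; exists x.
have [m [i iI im] mR] := Rmin big (ex_intro _ a biga).
exists (fun x y => slt (i x) (i y)); split.
- exact: (wf_inverse_image _ _ _ i sltwf).
- by move=> x y xy; apply: slt_tot => /iI.
- move=> x [j jI jx]; have /mR mx : big (i x).
    by exists (i \o j) => //; exact: inj_comp.
  by have [xm xNm] := im x; apply: xNm; exact: Ranti.
Qed.

(* The choice is by recursion along initial_well_order: at each step, fewer than
   #|T| finite sets of values are forbidden. *)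
Lemma conflict_free_choice (T : choiceType) (conf : T -> T -> T -> T -> Prop) :
  infinite_set [set: T] ->
  (forall s u t v, conf s u t v -> conf t v s u) ->
  (forall s u t, finite_set [set v | conf s u t v]) ->
  exists y : T -> T, forall s t, s <> t -> ~ conf s (y s) t (y t).
Proof.
move=> Tinf confC conf_fin.
have [lt [ltwf lt_tot lt_small]] := initial_well_order T.
pose step t (prev : forall s, lt s t -> T) : T :=
  (* The default [t] is returned only if every value is forbidden, which is excluded below. *)
  xget t [set v | forall s (st : lt s t), ~ conf s (prev s st) t v].
pose y := Fix ltwf (fun=> T) step.
have yE t : y t = step t (fun s _ => y s).
  apply: (Fix_eq ltwf (fun=> T) step) => x f g fg; congr step.
  by apply: functional_extensionality_dep => z;
     apply: functional_extensionality_dep => ?; exact: fg.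
suff ylt s t : lt s t -> ~ conf s (y s) t (y t).
  exists y => s t /lt_tot[/ylt//|/ylt + /confC]; exact.
suff /(_ t) : forall t, exists v, forall s, lt s t -> ~ conf s (y s) t v.
  move=> [v vP] st; rewrite [y t]yE /step.
  by case: xgetP => [w -> /(_ s st)//|/(_ v)]; case.
move=> {s}{}t; apply: contrapT => /forallNP nv.
have /choice[p pP] : forall v, exists s, lt s t /\ conf s (y s) t v.
  move=> v; have /existsNP[s /not_implyP[st /contrapT sv]] := nv v.
  by exists s.
pose A := [set s | lt s t].
have [Afin|Ainf] := pselect (finite_set A).
  apply: Tinf; have := bigcup_finite Afin (fun s _ => conf_fin s (y s) t).
  apply: sub_finite_set.
  by move=> v _; exists (p v); have [] := pP v.
have [|i iI] := @infinite_seq_injection (set_type A).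
  by rewrite (eq_finite_set (card_setT A)).
have [kn knI kA] := infinite_nat_injection Ainf.
pose kN n : A := SigSub (mem_set (kA n)).
(* The map [c s] numbers the finitely many values forbidden by [s], so [v] is determined by [p v]
   and its number. Coding this pair as a list over the segment below [t] embeds [T] into that
   segment. *)
have /choice[c cP] : forall s, exists c : T -> nat,
    forall u v, conf s (y s) t u -> conf s (y s) t v -> c u = c v -> u = v.
  move=> s; have /finite_set_countable/countable_injP[c cI] := conf_fin s (y s) t.
  by exists c => u v cu cv; apply: cI; exact: mem_set.
pose pA v : A := SigSub (mem_set (pP v).1).
apply: (lt_small t); exists (fun v => val (i [:: pA v; kN (c (p v) v)])).
  move=> u v /val_inj/iI[puv /knI].
  by rewrite -puv; apply: cP; [have []:= pP u|rewrite puv; have [] := pP v].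
by move=> v; exact: set_mem (valP (i _)).
Qed.

Local Open Scope ring_scope.

(** * The weak* topology *)

Lemma fmap_ultra (T U : Type) (f : T -> U) (F : set_system T) :
  UltraFilter F -> UltraFilter (f @ F).
Proof.
move=> FU; split; first exact: fmap_proper_filter.
move=> H HP FH; apply/seteqP; split=> // A HA.
have [//|FnA] := in_ultra_setVsetC (f @^-1` A) FU.
have HnA : H (~` A) by apply: FH.
have [x [Ax nAx]] := filter_ex (filterI HA HnA).
by case: nAx.
Qed.

Lemma ultra_cvg_compact (T : Type) (U : topologicalType) (f : T -> U)
  (F : set_system T) (A : set U) : UltraFilter F -> compact A ->
  F (f @^-1` A) -> exists2 l, A l & f @ F --> l.
Proof.
move=> FU; rewrite compact_ultra => /(_ _ (fmap_ultra f FU)) cA /cA[l [Al Fl]].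
by exists l.
Qed.

Lemma cvg_initial (S : choiceType) (T : topologicalType) (f : S -> T)
  (I : Type) (F : set_system I) (g : I -> initial_topology f) s : Filter F ->
  (f \o g) @ F --> f s -> g @ F --> (s : initial_topology f).
Proof.
move=> FF fgs U [_ [[W oW <-] Wfs WU]].
apply: filterS WU _; exact: (fgs _ (open_nbhs_nbhs (conj oW Wfs))).
Qed.

Section weak_star.
Context (R : realType) (V : normedModType R).

Lemma dual_cvg (I : Type) (F : set_system I) (g : I -> norm_dual V) (m : norm_dual V) :
  Filter F -> (forall f, (fun i => g i f) @ F --> (m f : R^o)) -> g @ F --> m.
Proof.
move=> FF gm.
have := @cvg_initial _ _ (fun m : norm_dual V => (dual_val m : {ptws V -> R^o})) _ F g m FF.
apply.
by apply/pointwise_cvgP => f; exact: gm.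
Qed.

Lemma dual_eval_continuous (f : V) : continuous (fun m : norm_dual V => m f : R^o).
Proof.
move=> m; have mc : (fun n : norm_dual V => dual_val n : {ptws V -> R^o}) @ m -->
    (dual_val m : {ptws V -> R^o}) by exact: initial_continuous.
by move/pointwise_cvgP : mc => /(_ (fmap_filter _ (nbhs_filter m))); exact.
Qed.

Lemma norm_dual_inj (m n : norm_dual V) : (forall f, m f = n f) -> m = n.
Proof. by move=> mn; apply/val_inj/funext. Qed.

Lemma norm_dual_hausdorff : hausdorff_space (norm_dual V).
Proof.
move=> m n mn; apply: norm_dual_inj => f.
apply: (@norm_hausdorff R R^o) => A B Am Bn.
have [k [Ak Bk]] := mn _ _ (dual_eval_continuous Am) (dual_eval_continuous Bn).
by exists (k f).
Qed.

Lemma dual_linear (m : norm_dual V) : linear (m : V -> R^o).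
Proof. by have /is_dualP[] := dual_valP m. Qed.

(** Banach-Alaoglu: along an ultrafilter each value [m f] converges in a compact segment, and the
    pointwise limit is linear. *)
Lemma dual_ball_compact : compact [set m : norm_dual V | forall f, `|m f| <= `|f|].
Proof.
rewrite compact_ultra => F FU Fball.
have mlim f : exists l, `|l| <= `|f| /\ (fun m : norm_dual V => m f) @ F --> (l : R^o).
  have [||l] := @ultra_cvg_compact _ R^o (fun m : norm_dual V => m f) F
      `[- `|f|, `|f|] FU.
  - exact: segment_compact.
  - by apply: filterS Fball => m /(_ f) /=; rewrite in_itv/= ler_norml.
  - by rewrite /= in_itv/= -ler_norml => lf Fl; exists l.
have [l lP] := choice mlim.
have l_dual : (l : V -> R^o) \in @is_dual R V.
  apply/is_dualP; split; last by exists 1 => f; rewrite mul1r; have [] := lP f.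
  move=> a f g; have [_ lfg] := lP (a *: f + g); have [_ lf] := lP f.
  have [_ lg] := lP g.
  apply: (@cvg_unique _ (@norm_hausdorff R R^o) _ _ _ _ lfg).
  have -> : (fun m : norm_dual V => m (a *: f + g)) =
      (fun m : norm_dual V => a *: (m f : R^o) + m g).
    by apply/funext => m; rewrite dual_linear.
  by apply: cvgD => //; apply: cvgZr.
exists (MkDual l_dual); split; first by move=> f; have [] := lP f.
by apply: dual_cvg => f; have [] := lP f.
Qed.

End weak_star.

(** * Pseudometrics on a locally compact group *)

Section topological_group.
Context (R : realType) (G : topologicalGroupType).

Lemma continuous_mulgl (x : G) : continuous (fun y : G => (x * y)%g).
Proof.
move=> y; apply: (@cvg_comp _ _ _ (fun y : G => (x, y))
  (fun xy : G * G => (xy.1 * xy.2)%g)); last exact: (mulg_continuous (x, y)).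
by apply: cvg_pair => //; exact: cvg_cst.
Qed.

Lemma continuous_mulgr (x : G) : continuous (fun y : G => (y * x)%g).
Proof.
move=> y; apply: (@cvg_comp _ _ _ (fun y : G => (y, x))
  (fun xy : G * G => (xy.1 * xy.2)%g)); last exact: (mulg_continuous (y, x)).
by apply: cvg_pair => //; exact: cvg_cst.
Qed.

(* Since D(x, 1) = sup_z |h(xz) - h(z)| is at least |h(x) - h(1)|, a bump
   function h at 1 turns the topology into a right-invariant pseudometric. *)
Section displacement.
Variables (h : G -> R) (V : set G).
Hypotheses (h_continuous : continuous (h : G -> R^o)) (V_compact : compact V).
Hypotheses (h01 : forall x, 0 <= h x <= 1) (h0 : forall x, ~ V x -> h x = 0).

Definition displacement (x y : G) : R :=
  sup [set `|h (x * z)%g - h (y * z)%g| | z in setT].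

Lemma displacement_ub x y z : `|h (x * z)%g - h (y * z)%g| <= displacement x y.
Proof.
apply: ub_le_sup; last by exists z.
exists 1 => _ [w _ <-]; rewrite ler_norml.
by have := h01 (x * w)%g; have := h01 (y * w)%g; lra.
Qed.

Lemma displacement_le x y (e : R) :
  (forall z, `|h (x * z)%g - h (y * z)%g| <= e) -> displacement x y <= e.
Proof.
move=> he; apply: ge_sup; first by exists `|h (x * 1)%g - h (y * 1)%g|, 1%g.
by move=> _ [z _ <-].
Qed.

Lemma displacement_ge0 x y : 0 <= displacement x y.
Proof. exact: le_trans (displacement_ub x y 1%g). Qed.

Lemma displacement_sym x y : displacement x y = displacement y x.
Proof.
by apply/eqP; rewrite eq_le; apply/andP; split; apply: displacement_le => z;
  rewrite distrC displacement_ub.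
Qed.

Lemma displacement_triangle x y z :
  displacement x z <= displacement x y + displacement y z.
Proof.
apply: displacement_le => w.
rewrite (le_trans (ler_distD (h (y * w)%g) _ _))//.
by rewrite lerD// displacement_ub.
Qed.

Lemma displacement_invariant x y z :
  displacement (x * z)%g (y * z)%g = displacement x y.
Proof.
apply/eqP; rewrite eq_le; apply/andP; split; apply: displacement_le => w.
  by rewrite -!mulgA displacement_ub.
have := displacement_ub (x * z)%g (y * z)%g (z^-1 * w)%g.
by rewrite !mulgA !mulgK.
Qed.

(** Compactness of [V] makes the estimate uniform for [z] in [V]. If only [u * z] lies in [V], the
    estimate is applied there with the inverse of [u]; if neither point does, [h] vanishes at
    both. *)
Lemma displacement_near1 (e : R) : 0 < e ->
  \forall u \near (1%g : G), displacement u 1%g <= e.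
Proof.
move=> e0; pose P (u : G) z := `|h (u * z)%g - h z| < e.
have nearP : \forall u \near (1%g : G), V `<=` P u.
  have /compact_near_coveringP := V_compact; apply => z Vz.
  have : (fun zu : G * G => h (zu.2 * zu.1)%g - h zu.1 : R^o) @ (z, 1%g) -->
      (h (1 * z)%g - h z : R^o).
    apply: cvgB.
      apply: (@cvg_comp _ _ _ (fun zu : G * G => (zu.2 * zu.1)%g) (h : G -> R^o));
        last exact: h_continuous.
      apply: (@cvg_comp _ _ _ (fun zu : G * G => (zu.2, zu.1))
        (fun xy : G * G => (xy.1 * xy.2)%g)); last exact: (mulg_continuous (1%g, z)).
      by apply: cvg_pair; [exact: cvg_snd|exact: cvg_fst].
    by apply: (@cvg_comp _ _ _ fst (h : G -> R^o)); [exact: cvg_fst|exact: h_continuous].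
  rewrite mul1g subrr => /cvgr0Pnorm_lt/(_ _ e0).
  by [].
have nearPV : \forall u \near (1%g : G), V `<=` P u^-1%g.
  have /(_ _ nearP) : (fun x : G => x^-1%g) @ (1%g : G) --> (1%g : G).
    by rewrite -[X in _ --> X]invg1; exact: invg_continuous.
  by [].
near=> u; apply: displacement_le => z; rewrite mul1g.
have [Vz|nVz] := pselect (V z).
  by apply/ltW; rewrite -/(P u z); apply: (near nearP u).
have [Vuz|nVuz] := pselect (V (u * z)%g).
  have : P u^-1%g (u * z)%g by apply: (near nearPV u).
  by rewrite /P mulKg distrC => /ltW.
by rewrite !h0// subrr normr0 ltW.
Unshelve. all: by end_near. Qed.

Lemma displacement_pseudometric : right_invariant_pseudometric displacement.
Proof.
split.
- exact: displacement_ge0.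
- move=> x; apply/eqP; rewrite eq_le displacement_ge0 andbT.
  by apply: displacement_le => z; rewrite subrr normr0.
- exact: displacement_sym.
- exact: displacement_triangle.
- exact: displacement_invariant.
(* Right invariance reduces continuity at [x0] to the identity. *)
have near_pt (x0 : G) (e : R) : 0 < e ->
    \forall x \near x0, displacement x x0 <= e.
  move=> e0.
  have /(_ _ (displacement_near1 e0)) :
      (fun x : G => (x * x0^-1)%g) @ (x0 : G) --> (1%g : G).
    by rewrite -[X in _ --> X](mulgV x0); exact: continuous_mulgr.
  move=> nD; near=> x.
  rewrite -(displacement_invariant x x0 x0^-1%g) mulgV.
  by near: x; exact: nD.
move=> [x0 y0]; apply/cvgrPdist_le => e e0 /=.
have e2 : 0 < e / 2 by rewrite divr_gt0.
near=> xy.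
have xx0 : displacement xy.1 x0 <= e / 2.
  by near: xy; apply: (cvg_fst (near_pt x0 _ e2)).
have yy0 : displacement xy.2 y0 <= e / 2.
  by near: xy; apply: (cvg_snd (near_pt y0 _ e2)).
rewrite ler_norml.
have := displacement_triangle x0 xy.1 y0.
have := displacement_triangle xy.1 xy.2 y0.
have := displacement_triangle xy.1 x0 xy.2.
have := displacement_triangle x0 y0 xy.2.
rewrite (displacement_sym x0 xy.1) (displacement_sym y0 xy.2).
by lra.
Unshelve. all: by end_near. Qed.

End displacement.

(** With [h] equal to 1 at the identity and 0 off a compact neighbourhood [V], any point outside [V]
    has displacement at least 1 from the identity. *)
Lemma compact_unit_ball_pseudometric :
  hausdorff_space G -> locally_compact [set: G] ->
  exists (D : G -> G -> R) (V : set G),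
    [/\ right_invariant_pseudometric D, compact V &
        forall x, D x 1%g < 1 -> V x].
Proof.
move=> Gh Glc; have := Glc 1%g I; rewrite withinET => -[V V1 [cV clV]].
have /(uniform_separatorP (R := R))[f [fc f01 f0 f1]] :
    uniform_separator [set (1%g : G)] (~` V°).
  apply: (@locally_compact_completely_regular G R Glc Gh).
    by apply: open_closedC; exact: open_interior.
  by move=> /(_ V1).
have f01' x : 0 <= f x <= 1 by have /= := f01 _ (imageT f x); rewrite in_itv.
pose h x := 1 - f x.
have hc : continuous (h : G -> R^o).
  by move=> x; apply: cvgB; [exact: cvg_cst|exact: fc].
have h01 x : 0 <= h x <= 1 by have := f01' x; rewrite /h; lra.
have h0 x : ~ V x -> h x = 0.
  move=> nVx; rewrite /h (f1 (f x)) ?subrr//; exists x => // Vx.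
  by apply: nVx; exact: interior_subset Vx.
exists (displacement h), V; split=> //.
  exact: displacement_pseudometric hc cV h01 h0.
move=> x Dx; apply: contrapT => nVx.
have := displacement_ub h01 x 1%g 1%g.
rewrite !mulg1 (h0 _ nVx) /h (f0 (f 1%g)) ?subr0 ?sub0r ?normrN ?normr1; last by exists 1%g.
by move=> /le_lt_trans/(_ Dx); rewrite ltxx.
Qed.

End topological_group.

(** * Interpolation by LUC functions on separated sets *)

Section interpolation.
Context (R : realType) (G : topologicalGroupType) (D : G -> G -> R).
Hypothesis DP : right_invariant_pseudometric D.

Lemma pseudometric_near (x : G) (e : R) : 0 < e -> \forall y \near x, D y x < e.
Proof.
move=> e0.
have : continuous (fun y : G => D y x : R^o).
  move=> y; apply: (@continuous_comp _ _ _ (fun y : G => (y, x))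
    (fun xy : G * G => D xy.1 xy.2 : R^o)); last exact: (rip_continuous DP).
  by apply: cvg_pair => //; exact: cvg_cst.
move=> /(_ x); rewrite /continuous_at (rip_refl DP) => /cvgr0Pnorm_lt/(_ _ e0); apply: filterS => y.
by apply: le_lt_trans; exact: ler_norm.
Qed.

(** This is the positive part of 1 minus the [D]-distance from [g] to [P]; the clause [r = 0] also
    covers empty [P]. *)
Definition hump (P : set G) (g : G) : R :=
  sup [set r | r = 0 \/ exists2 w, P w & r = 1 - D g w].

Lemma hump_ub P g w : P w -> 1 - D g w <= hump P g.
Proof.
move=> Pw; apply: ub_le_sup; last by right; exists w.
by exists 1 => _ [->|[v _ ->]]; rewrite ?ler01// gerBl (rip_ge0 DP).
Qed.

Lemma hump_ge0 P g : 0 <= hump P g.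
Proof.
apply: ub_le_sup; last by left.
by exists 1 => _ [->|[v _ ->]]; rewrite ?ler01// gerBl (rip_ge0 DP).
Qed.

Lemma hump_le P g (r : R) : 0 <= r -> (forall w, P w -> 1 - D g w <= r) ->
  hump P g <= r.
Proof.
move=> r0 rP; apply: ge_sup; first by exists 0; left.
by move=> _ [->//|[w /rP wr ->]].
Qed.

(** The hump is bounded by 1 and 1-Lipschitz for the right-invariant [D]. *)
Lemma hump_luc P : (hump P : G -> R^o) \in @is_luc R G.
Proof.
have lip g g' : hump P g <= hump P g' + D g g'.
  apply: hump_le => [|w Pw]; first by rewrite addr_ge0 ?hump_ge0 ?(rip_ge0 DP).
  have := hump_ub g' Pw; have := rip_triangle DP g' g w.
  by rewrite (rip_sym DP g' g); lra.
apply/is_lucP; split.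
  exists 1 => g; rewrite ger0_norm ?hump_ge0//; apply: hump_le => // w _.
  by rewrite gerBl (rip_ge0 DP).
move=> e e0; exists D, e; split=> // g g' gg'.
rewrite ltr_norml; have := lip g g'; have := lip g' g.
by rewrite (rip_sym DP g'); lra.
Qed.

Lemma hump1 P g : P g -> hump P g = 1.
Proof.
move=> Pg; apply/eqP; rewrite eq_le; apply/andP; split.
  by apply: hump_le => // w _; rewrite gerBl (rip_ge0 DP).
by have := hump_ub g Pg; rewrite (rip_refl DP) subr0.
Qed.

Lemma hump0 P g : (forall w, P w -> 1 <= D g w) -> hump P g = 0.
Proof.
move=> gP; apply/eqP; rewrite eq_le hump_ge0 andbT.
by apply: hump_le => // w /gP; rewrite subr_le0.
Qed.

Variables (V : set G) (T : choiceType) (x : T -> G).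
Hypotheses (V_compact : compact V) (DV : forall g, D g 1%g < 1 -> V g).
Hypothesis x_separated : forall s t, s <> t -> 1 <= D (x s) (x t).

(** These points [x t] lie in a translate of [V], which is compact. Infinitely many would cluster at
    some [l], and two of them within 1/2 of [l] would contradict separation. *)
Lemma separated_locally_finite (a w : G) :
  finite_set [set t | D (a * x t)%g w < 1].
Proof.
apply: contrapT => /infinite_nat_injection[j jI jD].
pose C := (fun v => (a^-1 * (v * w))%g) @` V.
have C_compact : compact C.
  apply: continuous_compact => //; apply: continuous_subspaceT.
  by move=> v; apply: (@continuous_comp _ _ _ (fun v : G => (v * w)%g)
    (fun v : G => (a^-1 * v)%g)); [exact: continuous_mulgr|exact: continuous_mulgl].
have xC n : C (x (j n)).
  exists (a * x (j n) * w^-1)%g; last by rewrite mulgVK mulKg.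
  by apply: DV; rewrite -(mulgV w) (rip_invariant DP); exact: jD.
have [|l [_ lP]] := C_compact ((fun n => x (j n)) @ \oo) _.
  by exists 0%N => // n _; exact: xC.
have half0 : (0 : R) < 1 / 2 by rewrite divr_gt0.
have freq N : exists2 n, (N <= n)%N & D (x (j n)) l < 1 / 2.
  have /lP/(_ (pseudometric_near l half0)) [_ [[n Nn <-] nl]] :
      ((fun n => x (j n)) @ \oo) [set x (j n) | n in [set n | (N <= n)%N]].
    by exists N => // n Nn; exists n.
  by exists n.
have [n _ nl] := freq 0%N; have [m nm ml] := freq n.+1.
have := x_separated (s := j m) (t := j n).
have mn : j m <> j n by move=> /jI mn; move: nm; rewrite mn ltnn.
move=> /(_ mn); have := rip_triangle DP (x (j m)) l (x (j n)).
by rewrite (rip_sym DP l); lra.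
Qed.

(** The function is the hump on the set of all points where the value 1 is prescribed; it suffices
    that all points with value 0 prescribed have distance at least 1 from that set. *)
Lemma luc_interpolation : infinite_set [set: T] ->
  exists f : LUC R G, forall (F : seq T) (z : T -> bool),
    exists y, forall t, t \in F -> f (x t * y)%g = (z t)%:R.
Proof.
move=> Tinf; have [i iI] := infinite_seq_injection Tinf.
(* Each pair (F, z) is coded by an index t, where e t = (F, [F | z]), and is
   interpolated at the point y = x (y t). *)
pose code (p : seq T * seq T) := i [:: i p.1; i p.2].
have codeI : injective code by move=> [p1 p2] [q1 q2] /iI[/iI -> /iI ->].
have [e eP] : exists e : T -> seq T * seq T, cancel code e.
  have /choice[e eP] : forall t, exists p, range code t -> code p = t.
    move=> t; have [[p _ pt]|n] := pselect (range code t); first by exists p.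
    by exists ([::], [::]).
  by exists e => p; apply: codeI; apply: eP; exists p.
(* A conflict means that the points prescribed for [s] with choice [u] and for [t] with choice [v]
   are not 1-separated. *)
pose conf s u t v := exists a b, [/\ a \in (e s).1, b \in (e t).1 &
  D (x a * x u)%g (x b * x v)%g < 1].
have confC s u t v : conf s u t v -> conf t v s u.
  by move=> [a [b [ae be ab]]]; exists b, a; rewrite (rip_sym DP).
have conf_fin s u t : finite_set [set v | conf s u t v].
  have fin := bigcup_finite (finite_seq (e s).1) (fun a _ =>
    bigcup_finite (finite_seq (e t).1) (fun b _ =>
      separated_locally_finite (x b) (x a * x u)%g)).
  apply: sub_finite_set fin => v [a [b [ae be ab]]].
  by exists a => //; exists b => //=; rewrite (rip_sym DP).
have [y yP] := conflict_free_choice Tinf confC conf_fin.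
pose P := [set w | exists t a, [/\ a \in (e t).1, a \in (e t).2 & w = (x a * x (y t))%g]].
exists (MkLUC (hump_luc P)) => F z; pose t := code (F, [seq a <- F | z a]).
have et : e t = (F, [seq a <- F | z a]) by exact: eP.
exists (x (y t)) => a aF /=; case: (boolP (z a)) => [za|nza].
  by apply: hump1; exists t, a; rewrite et mem_filter za aF.
(* For equal codes the common right factor cancels and [x] is separated; for different codes the
   choice is free of conflicts. *)
apply: hump0 => _ [s [b [bs1 bs2 ->]]]; have [st|/eqP st] := eqVneq t s.
  rewrite -st (rip_invariant DP); apply: x_separated => ab.
  by move: bs2; rewrite -st et mem_filter -ab (negbTE nza).
rewrite leNgt; apply/negP => ab; apply: (yP _ _ st).
by exists a, b; rewrite et.
Qed.

End interpolation.

(** * Sets without the Baire property *)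

Definition cylinder (K : Type) (T : eqType) (q : K -> T -> bool) (F : seq T)
    (z : T -> bool) : set K :=
  [set k | forall t, t \in F -> q k t = z t].

Section flip.
Context (K : topologicalType) (T : eqType) (q : K -> T -> bool).
Hypothesis q_surj : forall z, exists k, q k = z.
Hypothesis cylinder_open : forall F z, open (cylinder q F z).
Hypothesis cylinder_base : forall O : set K, open O -> O !=set0 ->
  exists F z, cylinder q F z `<=` O.

(** The cylinder minus the closure of [N] is open and nonempty, so it contains a cylinder of some
    [z1]; as [q] takes the value [z1] there, [z1] agrees with [z] on [F]. *)
Lemma cylinder_avoid (N : set K) (F : seq T) (z : T -> bool) :
  nowhere_dense N -> exists F' z', [/\ {subset F <= F'},
    {in F, z' =1 z} & cylinder q F' z' `&` N = set0].
Proof.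
move=> Nnd; have [k0 k0z] := q_surj z.
have [] := cylinder_base (O := cylinder q F z `&` ~` closure N).
- by apply: openI; [exact: cylinder_open|rewrite openC; exact: closed_closure].
- apply: contrapT => /forallNP nO.
  have : (closure N)° k0.
    rewrite /interior; apply: (@filterS _ _ _ (cylinder q F z)).
      by move=> k kF; apply: contrapT => nk; exact: (nO k).
    apply: open_nbhs_nbhs; split; first exact: cylinder_open.
    by move=> t _; rewrite k0z.
  by rewrite Nnd.
move=> F1 [z1 F1O]; have [k1 k1z] := q_surj z1; exists (F ++ F1), z1; split.
- by move=> t; rewrite mem_cat => ->.
- by move=> t tF; rewrite -k1z; have [|k1F _] := F1O k1; [by move=> u _; rewrite k1z|exact: k1F].
- rewrite -subset0 => k [kF Nk]; have [|_] := F1O k.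
    by move=> t tF; apply: kF; rewrite mem_cat tF orbT.
  by apply; exact: subset_closure.
Qed.

(* Off a meager set B is constant on some cylinder; a point of that cylinder and
   its flip outside F0 are built to avoid the meager set simultaneously. *)
Lemma flip_not_baire (B : set K) :
  (forall (F : seq T) k k', (forall t, t \notin F -> q k' t = ~~ q k t) ->
     (B k <-> ~ B k')) ->
  ~ baire_property B.
Proof.
move=> Bflip [U [oU [N [Nnd BUN]]]].
(* If [U] is empty, [B] is meager and [b] is [False]; otherwise a cylinder inside [U] works with [b]
   equal to [True]. *)
have [F0 [z0 [b bP]]] : exists F0 z0 (b : Prop), forall k, cylinder q F0 z0 k ->
    ~ (\bigcup_n N n) k -> (B k <-> b).
  have [U0|/set0P Une] := eqVneq U set0.
    exists [::], (fun=> true), False => k _ Nk; split=> // Bk; apply: Nk.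
    by rewrite -BUN U0; left; split.
  have [F [z FU]] := cylinder_base oU Une; exists F, z, True => k /FU Uk Nk.
  by split=> // _; apply: contrapT => nBk; apply: Nk; rewrite -BUN; right; split.
pose flip (z : T -> bool) t := if t \in F0 then z t else ~~ z t.
have flipK z : flip (flip z) = z.
  by apply/funext => t; rewrite /flip; case: (t \in F0); rewrite ?negbK.
(* One step shrinks the cylinder off [N n], flips, shrinks again and flips back. *)
have /choice[nxt nxtP] : forall p : nat * (seq T * (T -> bool)), exists r,
    [/\ {subset p.2.1 <= r.1}, {in p.2.1, r.2 =1 p.2.2},
        cylinder q r.1 r.2 `&` N p.1 = set0 &
        cylinder q r.1 (flip r.2) `&` N p.1 = set0].
  move=> [n [F z]] /=.
  have [F1 [z1 [FF1 z1z FN1]]] := cylinder_avoid F z (Nnd n).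
  have [F2 [z2 [FF2 z2z FN2]]] := cylinder_avoid F1 (flip z1) (Nnd n).
  have z12 : {in F1, flip z2 =1 z1}.
    by move=> t /z2z z2t; rewrite -[in RHS](flipK z1) {1}/flip z2t.
  exists (F2, flip z2); split=> /=.
  - by move=> t /FF1/FF2.
  - by move=> t tF; rewrite z12 ?z1z//; exact: FF1.
  - rewrite -subset0 -FN1 => k [kF Nk]; split=> // t tF.
    by rewrite kF ?z12//; exact: FF2.
  - by rewrite flipK.
pose fix s n := if n is m.+1 then nxt (m, s m) else (F0, z0).
have sS n : [/\ {subset (s n).1 <= (s n.+1).1}, {in (s n).1, (s n.+1).2 =1 (s n).2},
    cylinder q (s n.+1).1 (s n.+1).2 `&` N n = set0 &
    cylinder q (s n.+1).1 (flip (s n.+1).2) `&` N n = set0].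
  exact: (nxtP (n, s n)).
have smono n m : (n <= m)%N -> {subset (s n).1 <= (s m).1} /\
    {in (s n).1, (s m).2 =1 (s n).2}.
  move=> /subnK <-; elim: (m - n)%N => [|d [IH1 IH2]]; first by split.
  have [S1 S2 _ _] := sS (d + n)%N; split=> t tn.
    exact/S1/IH1.
  by rewrite -IH2// -S2//; exact: IH1.
(* The finite conditions have a common extension [z], set to [true] where none of them decides. *)
have /choice[z zP] : forall t, exists b, forall n, t \in (s n).1 -> b = (s n).2 t.
  move=> t; have [[n tn]|nt] := pselect (exists n, t \in (s n).1); last first.
    by exists true => n tn; case: nt; exists n.
  exists ((s n).2 t) => m tm; have [nm|/ltnW mn] := leqP n m.
    by rewrite (smono _ _ nm).2.
  by rewrite (smono _ _ mn).2.
have [k kz] := q_surj z; have [k' k'z] := q_surj (flip z).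
have kN : ~ (\bigcup_n N n) k.
  move=> [n _ Nk]; have [_ _ + _] := sS n; rewrite -subset0 => /(_ k); apply; split.
    by move=> t tn; rewrite kz (zP _ _ tn).
  exact: Nk.
have k'N : ~ (\bigcup_n N n) k'.
  move=> [n _ Nk]; have [_ _ _ +] := sS n; rewrite -subset0 => /(_ k'); apply; split.
    by move=> t tn; rewrite k'z /flip (zP _ _ tn).
  exact: Nk.
have kF0 : cylinder q F0 z0 k by move=> t tF; rewrite kz (zP t 0%N).
have k'F0 : cylinder q F0 z0 k'.
  by move=> t tF; rewrite k'z /flip tF (zP t 0%N).
have Bk := bP k kF0 kN; have Bk' := bP k' k'F0 k'N.
have : B k <-> ~ B k'.
  by apply: (Bflip F0) => t tF; rewrite k'z kz /flip (negbTE tF).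
by tauto.
Qed.

End flip.

(* Minimality of K among the closed sets that q maps onto all functions
   T -> bool makes the traces on K of the cylinders a pi-base of K. *)
Section irreducible.
Context (X : topologicalType) (T : eqType) (q : X -> T -> bool) (N : set X).
Hypothesis N_compact : compact N.
Hypothesis fiber_closed : forall t b, closed (N `&` [set k | q k t = b]).
Hypothesis q_surj : forall z, exists2 k, N k & q k = z.

Lemma irreducible_restriction : closed N -> exists K : set X,
  [/\ closed K, K `<=` N, forall z, exists2 k, K k & q k = z &
      forall O : set X, open O -> (K `&` O) !=set0 ->
        exists F z, K `&` cylinder q F z `<=` O].
Proof.
move=> N_closed.
have cyl_closed F z : closed (N `&` cylinder q F z).
  have -> : N `&` cylinder q F z = N `&` \bigcap_(t in [set` F])
      (N `&` [set k | q k t = z t]).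
    apply/seteqP; split=> k [Nk kF]; split=> //.
      by move=> t tF; split=> //; exact: kF.
    by move=> t tF; have [] := kF t tF.
  by apply: closedI => //; apply: closed_bigI => t _; exact: fiber_closed.
have fib_closed z : closed (N `&` [set k | q k = z]).
  have -> : N `&` [set k | q k = z] = N `&` \bigcap_t
      (N `&` [set k | q k t = z t]).
    apply/seteqP; split=> k [Nk kF]; split=> //.
      by move=> t _; split=> //=; rewrite kF.
    by apply/funext => t; have [] := kF t I.
  by apply: closedI => //; apply: closed_bigI => t _; exact: fiber_closed.
(* Zorn is applied to the open sets whose removal from [N] keeps [q] onto. Unions of chains qualify
   by compactness of [N]. *)
pose P A := open A /\ forall z, exists k, [/\ N k, ~ A k & q k = z].
have [F FP Ftot|A [[oA Asurj] Amax]] := @Zorn_bigcup _ P.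
  split; first by apply: bigcup_open => A /FP[].
  move=> z; have [F0|/set0P[A0 FA0]] := eqVneq F set0.
    by have [k Nk kz] := q_surj z; exists k; split=> //; rewrite F0 => -[].
  pose C A := N `&` [set k | q k = z] `&` ~` A.
  have C_closed A : F A -> closed (C A).
    by move=> /FP[oA _]; apply: closedI => //; exact: open_closedC.
  have FF : ProperFilter (filter_from F C).
    apply: filter_from_proper.
      apply: filter_from_filter; first by exists A0.
      move=> A B FA FB; have [AB|BA] := Ftot _ _ FA FB.
        by exists B => // k [Nk nBk]; split; split=> // /AB.
      by exists A => // k [Nk nAk]; split; split=> // /BA.
    by move=> A /FP[_ /(_ z)[k [Nk nA kz]]]; exists k.
  have [|k [Nk]] := N_compact FF; first by exists A0 => // k [[]].
  rewrite clusterE => kF; have kC A : F A -> C A k.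
    by move=> FA; rewrite [C A](closure_id _).1; [apply: kF; exists A|exact: C_closed].
  exists k; split=> //; last by have [[]] := kC _ FA0.
  by move=> [A FA Ak]; have [_] := kC _ FA.
exists (N `&` ~` A); split.
- by apply: closedI => //; exact: open_closedC.
- exact: subIsetl.
- by move=> z; have [k [? ? ?]] := Asurj z; exists k.
move=> O oO [k0 [[Nk0 nAk0] Ok0]].
have /not_andP[[]|] : ~ P (A `|` O).
  apply: Amax; split; first exact: subsetUl.
  by move=> /(_ k0 (or_intror Ok0)).
- exact: openU.
move=> /existsNP[z zP].
apply: contrapT => nF.
(* The value [z] is lost when [O] is removed too. Were every cylinder of [z] to meet the rest of
   [N], compactness would yield a point there with value [z]. *)
pose C F := N `&` cylinder q F z `&` ~` (A `|` O).
have C_closed F : closed (C F).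
  by apply: closedI => //; apply: open_closedC; exact: openU.
have FF : ProperFilter (filter_from setT C).
  apply: filter_from_proper.
    apply: filter_from_filter; first by exists [::].
    move=> F F' _ _; exists (F ++ F') => // k [[Nk kF] nk].
    by split; split=> //; split=> // t tF; apply: kF; rewrite mem_cat tF ?orbT.
  move=> F _; apply: contrapT => /forallNP CF; apply: nF; exists F, z.
  move=> k [[Nk nAk] kF]; apply: contrapT => nOk; apply: (CF k).
  by split=> // -[].
have [|k [Nk]] := N_compact FF; first by exists [::] => // k [[]].
rewrite clusterE => kF; have kC F : C F k.
  by rewrite [C F](closure_id _).1; [apply: kF; exists F|exact: C_closed].
apply: zP; exists k; split=> //.
  by have [_] := kC [::].
apply/funext => t; have [[_ + ] _] := kC [:: t].
by apply; rewrite mem_head.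
Qed.

End irreducible.

(** * Topological centres *)

Lemma set_type_compact (X : topologicalType) (A : set X) :
  compact A -> compact [set: A].
Proof.
move=> cA; rewrite compact_ultra => F FU _.
have [|l Al Fl] := ultra_cvg_compact (f := set_val : A -> X) FU cA.
  by apply: (filterS (P := setT)); [move=> k _; exact: set_mem (valP k)|exact: filterT].
exists (SigSub (mem_set Al)); split=> //.
exact: (@cvg_initial A X set_val A F id (SigSub (mem_set Al))).
Qed.

Lemma set_type_hausdorff (X : topologicalType) (A : set X) :
  hausdorff_space X -> hausdorff_space A.
Proof.
move=> hX k l kl; apply: val_inj; apply: hX => U W Uk Wl.
have val_cont : continuous (set_val : A -> X) by exact: initial_continuous.
have [j [Uj Wj]] := kl _ _ (val_cont _ _ Uk) (val_cont _ _ Wl).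
by exists (val j).
Qed.

Lemma open_baire_property (K : topologicalType) (U : set K) :
  open U -> baire_property U.
Proof.
move=> oU; exists U; split=> //; exists (fun=> set0); split.
  by move=> _; rewrite /nowhere_dense closure0 interior0.
by rewrite setYK bigcup0.
Qed.

Section compactification.
Context (R : realType) (G : topologicalGroupType).
Local Notation S := (LUC_compactification R G).

Lemma compactification_compact : compact S.
Proof.
have cB := @dual_ball_compact R (LUC R G).
apply: (subclosed_compact _ cB); first exact: closed_closure.
have clB := compact_closed (@norm_dual_hausdorff R (LUC R G)) cB.
rewrite [X in _ `<=` X](closure_id _).1//; apply: closure_subset.
by move=> _ [x _ <-] f /=; exact: luc_norm_ub.
Qed.

(** As [m] is in the closure of the evaluations, the traces of its neighbourhoods on [G] generate a
    proper filter, refined here to an ultrafilter. *)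
Lemma compactification_ultra (m : norm_dual (LUC R G)) : S m ->
  exists2 p : set_system G, UltraFilter p &
    forall f : LUC R G, (fun x => f x : R^o) @ p --> (m f : R^o).
Proof.
move=> Sm; pose F := filter_from (nbhs m) (fun U => luc_eval R @^-1` U).
have FF : ProperFilter F.
  apply: filter_from_proper.
    apply: filter_from_filter; first by exists setT; exact: filterT.
    by move=> U W mU mW; exists (U `&` W) => //; exact: filterI.
  by move=> U /Sm[_ [[x _ <-] Ux]]; exists x.
have [p [pU Fp]] := ultraFilterLemma FF; exists p => // f.
have pm : luc_eval R @ p --> m by move=> U mU; apply: Fp; exists U.
apply: (@cvg_comp _ _ _ (luc_eval R) (fun m : norm_dual (LUC R G) => m f : R^o)).
  exact: pm.
exact: dual_eval_continuous.
Qed.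

(** Convolution on the left with the evaluation at [x] sends [n] to its value at a translate of
    [f]. *)
Lemma eval_Lambda (x : G) : Lambda S (luc_eval R x).
Proof.
split; first by apply: subset_closure; exists x.
move=> f k; apply: (@continuous_comp _ _ _ (set_val : S -> norm_dual (LUC R G))
  (fun n : norm_dual (LUC R G) => n (luc_translate x f) : R^o)).
  exact: initial_continuous.
exact: dual_eval_continuous.
Qed.

Lemma Lambda_sub_CBP : Lambda S `<=` Lambda_CBP S.
Proof.
move=> m [Sm mc]; split=> // f U oU K phi _ _ phic.
apply: open_baire_property.
have /continuousP/(_ _ oU) oh := mc f.
by move/continuousP : phic; apply; exact: oh.
Qed.

(* For n in N, conv m n f is the p-limit of the 0-1 values q n t, so
   {n | conv m n f > 1/2} is the preimage under q of the free ultrafilter p,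
   seen as a subset of 2^T. *)
Section nonprincipal.
Variables (m : norm_dual (LUC R G)) (u : G) (T : choiceType) (x : T -> G).
Variables (p : set_system T).
Hypotheses (p_ultra : UltraFilter p)
  (p_cvg : forall f : LUC R G, (fun t => f (u * x t)%g : R^o) @ p --> (m f : R^o))
  (p_free : forall t, ~ p [set t]).
Variable f : LUC R G.
Hypothesis f_interp : forall (F : seq T) (z : T -> bool),
  exists y, forall t, t \in F -> f (u * x t * y)%g = (z t)%:R.

Let g (t : T) := luc_translate (u * x t)%g f.

Let q (n : norm_dual (LUC R G)) (t : T) : bool := n (g t) == 1.

(** The equation says that every coordinate [n (g t)] is 0 or 1. *)
Let N := S `&` [set n : norm_dual (LUC R G) | forall t, n (g t) = (q n t)%:R].

Lemma p_finite (s : seq T) : p [set t | t \notin s].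
Proof.
elim: s => [|t s IH]; first by apply: filterS filterT.
have [/p_free//|nt] := in_ultra_setVsetC [set t] p_ultra.
apply: filterS (filterI IH nt) => t' [/= t's t't].
by rewrite inE negb_or t's andbT; apply/eqP.
Qed.

(** The points interpolating [z] on finite sets form a filter base; the limit of evaluations along a
    finer ultrafilter realises all of [z]. *)
Lemma N_surj z : exists2 n, N n & q n = z.
Proof.
pose C (F : seq T) := [set y : G | forall t, t \in F -> f (u * x t * y)%g = (z t)%:R].
have FF : ProperFilter (filter_from [set: seq T] C).
  apply: filter_from_proper.
    apply: filter_from_filter; first by exists [::].
    move=> F F' _ _; exists (F ++ F') => // y yF.
    by split=> t tF; apply: yF; rewrite mem_cat tF ?orbT.
  by move=> F _; exact: f_interp.
have [v [vU Fv]] := ultraFilterLemma FF.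
have [|n Sn vn] := ultra_cvg_compact (f := @luc_eval R G) vU compactification_compact.
  by apply: filterS filterT => y _; apply: subset_closure; exists y.
have ng t : n (g t) = (z t)%:R.
  have vg : (fun y => g t y : R^o) @ v --> (n (g t) : R^o).
    apply: (@cvg_comp _ _ _ (luc_eval R) (fun n : norm_dual (LUC R G) => n (g t) : R^o)).
      exact: vn.
    exact: dual_eval_continuous.
  have vz : (fun y => g t y : R^o) @ v --> ((z t)%:R : R^o).
    apply: (cvg_trans (near_eq_cvg _) (cvg_cst _)).
    have /Fv : filter_from setT C (C [:: t]) by exists [:: t].
    by apply: filterS => y /(_ t (mem_head _ _)) /= ->.
  exact: (@cvg_unique _ (@norm_hausdorff R R^o) _ _ _ _ vg vz).
have qn : q n = z.
  by apply/funext => t; rewrite /q ng; case: (z t); rewrite ?eqxx// eq_sym oner_eq0.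
by exists n => //; split=> // t; rewrite /= ng qn.
Qed.

Let eval_closed (t : T) (A : set R^o) : closed A ->
  closed [set n : norm_dual (LUC R G) | A (n (g t))].
Proof.
move=> cA; apply: (closed_comp
  (f := fun n : norm_dual (LUC R G) => n (g t) : R^o)) => // n _.
exact: dual_eval_continuous.
Qed.

Lemma N_closed : closed N.
Proof.
have -> : N = S `&` \bigcap_t
    [set n : norm_dual (LUC R G) | [set (0 : R^o); (1 : R^o)] (n (g t))].
  apply/seteqP; split=> n [Sn nq]; split=> // t.
    by move=> _ /=; rewrite nq; case: (q n t); [right|left].
  have := nq t I; rewrite /= /q => -[] ->; last by rewrite eqxx.
  by rewrite eq_sym oner_eq0.
apply: closedI; first exact: closed_closure.
by apply: closed_bigI => t _; apply: eval_closed; apply: closedU; exact: closed_eq.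
Qed.

Lemma N_fiber_closed t b : closed (N `&` [set n | q n t = b]).
Proof.
have -> : N `&` [set n | q n t = b] = N `&`
    [set n : norm_dual (LUC R G) | [set (b%:R : R^o)] (n (g t))].
  apply/seteqP; split=> n [[Sn nq] /= nb]; split=> //=; first by rewrite nq nb.
  by rewrite /q nb; case: (b); rewrite ?eqxx// eq_sym oner_eq0.
by apply: closedI; [exact: N_closed|apply: eval_closed; exact: closed_eq].
Qed.

Lemma conv_half n : N n -> (1 / 2 < Defs.conv m n f <-> p [set t | q n t]).
Proof.
move=> [Sn nq]; have cv := @p_cvg (luc_act n f).
(* The function [luc_act n f] takes the value [n (g t)] at [u * x t]. *)
have lim_eq (b : bool) : p [set t | q n t = b] -> Defs.conv m n f = b%:R.
  move=> pb; apply: (@cvg_unique _ (@norm_hausdorff R R^o) _ _ _ _ cv).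
  apply: (cvg_trans (near_eq_cvg _) (cvg_cst _)).
  by apply: filterS pb => t /= tb; rewrite -/(g t) nq tb.
have half_lt (b : bool) : (1 / 2 < b%:R :> R) = b.
  by case: b; [rewrite mulr1n|rewrite mulr0n]; apply/idP/idP; lra.
split=> [half|/(lim_eq true) ->]; last by rewrite half_lt.
have [//|pn] := in_ultra_setVsetC [set t | q n t] p_ultra.
have : p [set t | q n t = false] by apply: filterS pn => t /negP/negbTE.
by move/lim_eq => c0; move: half; rewrite c0 half_lt.
Qed.

Lemma nonprincipal_not_CBP : ~ CBP_measurable (fun n : S => Defs.conv m (set_val n) f : R^o).
Proof.
move=> mCBP.
have N_compact : compact N.
  by apply: subclosed_compact N_closed compactification_compact _; exact: subIsetl.
have [K [clK KN Ksurj Kbase]] :=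
  irreducible_restriction N_compact N_fiber_closed N_surj N_closed.
have KS k : K k -> S k by move=> /KN[].
pose phi (k : K) : S := SigSub (mem_set (KS _ (set_mem (valP k)))).
have val_cont : continuous (set_val : K -> norm_dual (LUC R G)).
  exact: initial_continuous.
have phi_cont : continuous phi by apply: continuous_comp_initial.
have cK : compact [set: K].
  apply: set_type_compact; exact: (subclosed_compact clK N_compact KN).
have hK : hausdorff_space K by apply: set_type_hausdorff; exact: norm_dual_hausdorff.
have := mCBP [set r : R^o | 1 / 2 < r] (@open_gt R (1/2)) K phi cK hK phi_cont.
pose qK (k : K) := q (val k).
(* Coordinates are 0 or 1 on [K], so open half-lines at 1/2 separate the two values. *)
have q_open t b : open [set k : K | qK k t = b].
  have ev_cont : continuous (fun k : K => val k (g t) : R^o).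
    move=> k; apply: (@continuous_comp _ _ _ (set_val : K -> norm_dual (LUC R G))
      (fun n : norm_dual (LUC R G) => n (g t) : R^o)); first exact: val_cont.
    exact: dual_eval_continuous.
  have qE (k : K) : val k (g t) = (qK k t)%:R.
    by have [_] := KN _ (set_mem (valP k)); apply.
  case: b.
    have -> : [set k : K | qK k t = true] = (fun k : K => val k (g t) : R^o) @^-1` [set r | 1/2 < r].
      by apply/seteqP; split=> k /=; rewrite qE; case: (qK k t) => //=; lra.
    by apply: open_comp; [move=> k _; exact: ev_cont|exact: open_gt].
  have -> : [set k : K | qK k t = false] = (fun k : K => val k (g t) : R^o) @^-1` [set r | r < 1/2].
    by apply/seteqP; split=> k /=; rewrite qE; case: (qK k t) => //=; lra.
  by apply: open_comp; [move=> k _; exact: ev_cont|exact: open_lt].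
apply: (flip_not_baire (q := qK)).
- by move=> z; have [k Kk kz] := Ksurj z; exists (SigSub (mem_set Kk)).
- move=> F z; elim: F => [|t F IH].
    by have -> : cylinder qK [::] z = setT; [apply/seteqP; split|exact: openT].
  have -> : cylinder qK (t :: F) z = [set k | qK k t = z t] `&` cylinder qK F z.
    apply/seteqP; split=> [k kF|k [kt kF] s].
      split; first exact: kF (mem_head _ _).
      by move=> s sF; apply: kF; rewrite inE sF orbT.
    by rewrite inE => /predU1P[->//|]; exact: kF.
  exact: openI.
- move=> _ [A oA <-] [k Ak].
  have [|F [z Fz]] := Kbase A oA; first by exists (val k); split=> //; exact: set_mem (valP k).
  exists F, z => l lF; apply: Fz; split=> //; exact: set_mem (valP l).
- move=> F k k' kk'.
  have Bq (l : K) : (phi @^-1` ((fun n : S => Defs.conv m (set_val n) f : R^o) @^-1`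
      [set r : R^o | 1 / 2 < r])) l <-> p [set t | qK l t].
    by apply: conv_half; exact: KN (set_mem (valP l)).
  (* The index sets of [k] and [k'] are complementary off the finite [F], so exactly one of them is
     in [p]. *)
  rewrite !Bq; split=> [pk pk'|npk'].
    have [t [/= tF [kt k't]]] := filter_ex (filterI (p_finite F) (filterI pk pk')).
    by move: k't; rewrite /= kk'// kt.
  have [//|pn] := in_ultra_setVsetC [set t | qK k t] p_ultra.
  exfalso; apply: npk'; apply: filterS (filterI (p_finite F) pn) => t [/= tF /negP].
  by rewrite kk'.
Qed.

End nonprincipal.
End compactification.

(** * Separated nets and the determination of the centres *)

Lemma maximal_separated_set (R : realType) (G : topologicalGroupType)
    (D : G -> G -> R) : right_invariant_pseudometric D ->
  exists A : set G, (forall x y, A x -> A y -> x <> y -> 1 <= D x y) /\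
    forall g, exists2 x, A x & D g x < 1.
Proof.
move=> DP; pose P A := forall x y : G, A x -> A y -> x <> y -> 1 <= D x y.
have [F FP Ftot|A [PA Amax]] := @Zorn_bigcup _ P.
  move=> x y [A FA Ax] [B FB By]; have [AB|BA] := Ftot _ _ FA FB.
    by apply: (FP _ FB) => //; exact: AB.
  by apply: (FP _ FA) => //; exact: BA.
exists A; split=> // g; apply: contrapT => ng.
have gA x : A x -> 1 <= D g x.
  by move=> Ax; rewrite leNgt; apply/negP => gx; apply: ng; exists x.
apply: (Amax (A `|` [set g])).
  split; first exact: subsetUl.
  move=> /(_ g (or_intror erefl)) /gA; rewrite (rip_refl DP).
  by rewrite leNgt ltr01.
move=> x y [Ax|->] [Ay|->] // xy; first exact: PA.
  by rewrite (rip_sym DP); exact: gA.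
exact: gA.
Qed.

Lemma Lambda_CBP_sub_range (R : realType) (G : topologicalGroupType) :
  hausdorff_space G -> locally_compact [set: G] ->
  Lambda_CBP (LUC_compactification R G) `<=` range (@luc_eval R G).
Proof.
move=> Gh Glc m [Sm mCBP].
have [D [V [DP cV DV]]] := @compact_unit_ball_pseudometric R G Gh Glc.
have [A [Asep Acov]] := maximal_separated_set DP.
have [p pU pm] := compactification_ultra Sm.
have /choice[rho rhoP] : forall g, exists t : A, D g (val t) < 1.
  by move=> g; have [x Ax gx] := Acov g; exists (SigSub (mem_set Ax)).
(* Each [g] factors as [v g] in the compact [V] times the net point [rho g]. *)
pose v g := (g * (val (rho g))^-1)%g.
have [|u _ vu] := ultra_cvg_compact (f := v) pU cV.
  apply: (filterS (P := setT)); last exact: filterT.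
  by move=> g _; apply: DV; rewrite -(mulgV (val (rho g))) (rip_invariant DP).
(* By right invariance [g] is as close to [u * val (rho g)] as [v g] is to [u], so [f] has the same
   limit at both. *)
have rm (f : LUC R G) : (fun g => f (u * val (rho g))%g : R^o) @ p --> (m f : R^o).
  have -> : m f = m f - 0 :> R^o by rewrite subr0.
  have -> : (fun g => f (u * val (rho g))%g : R^o) =
      (fun g => f g - (f g - f (u * val (rho g))%g) : R^o).
    by apply/funext => g; rewrite subKr.
  apply: cvgB; first exact: pm.
  apply/cvgr0Pnorm_lt => e; have /is_lucP[_ fu] := luc_valP f.
  move=> /fu[E [d [EP d0 Ef]]].
  have pv : p [set g | E (v g) u < d] := vu _ (pseudometric_near EP u d0).
  apply: filterS pv => g /= vg.
  apply: Ef; rewrite -(rip_invariant EP _ _ (val (rho g))^-1%g).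
  by rewrite mulgK.
pose T : choiceType := set_type A.
pose p' : set_system T := rho @ p.
have p'U : UltraFilter p' by exact: fmap_ultra.
have p'm (f : LUC R G) : (fun t : T => f (u * val t)%g : R^o) @ p' --> (m f : R^o).
  exact: rm.
have [[t p't]|/forallNP p'free] := pselect (exists t, p' [set t]).
  exists (u * val t)%g => //; apply: norm_dual_inj => f /=.
  apply: (@cvg_unique _ (@norm_hausdorff R R^o) _ _ _ _ _ (p'm f)).
  apply: (cvg_trans (near_eq_cvg _) (cvg_cst _)).
  by apply: filterS p't => s /= ->.
exfalso.
have Tinf : infinite_set [set: T].
  move=> /finite_seqP[s sT]; have [t /= ts] := filter_ex (p_finite p'U p'free s).
  have : [set: T] t by [].
  by rewrite sT /= (negbTE ts).
have Tsep (s t : T) : s <> t -> 1 <= D (val s) (val t).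
  move=> st; apply: Asep; try exact: set_mem (valP _).
  by move=> /val_inj.
have [f fP] := luc_interpolation DP cV DV Tsep Tinf.
(* Translating [f] by the inverse of [u] cancels the factor [u]. *)
have f_interp (F : seq T) (z : T -> bool) : exists y, forall t, t \in F ->
    luc_translate u^-1%g f (u * val t * y)%g = (z t)%:R.
  have [y yF] := fP F z; exists y => t tF /=.
  by rewrite -mulgA mulKg yF.
exact: (nonprincipal_not_CBP p'U p'm p'free f_interp (mCBP _)).
Qed.

Theorem corollary3p3 (R : realType) (G : topologicalGroupType)
    (G_hausdorff : hausdorff_space G)
    (G_locally_compact : locally_compact [set: G]) :
  Lambda (LUC_compactification R G) = Lambda_CBP (LUC_compactification R G) /\
  Lambda_CBP (LUC_compactification R G) = range (@luc_eval R G).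
Proof.
have CBP_range := @Lambda_CBP_sub_range R G G_hausdorff G_locally_compact.
have range_Lambda : range (@luc_eval R G) `<=` Lambda (LUC_compactification R G).
  by move=> _ [x _ <-]; exact: eval_Lambda.
split; apply/seteqP; split.
- exact: Lambda_sub_CBP.
- by move=> m /CBP_range/range_Lambda.
- exact: CBP_range.
- by move=> m /range_Lambda; exact: Lambda_sub_CBP.
Qed.
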